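(* The definability order $\langle c\mathrm{DEF},\lhd\rangle$ (modulo mutual definability) forms a distributive lattice. For $\alpha,\beta\in c\mathrm{DEF}$, the infimum of $\alpha$ and $\beta$ is (the class of) $\alpha\vee\beta$, and the supremum of $\alpha$ and $\beta$ is (the class of) $\alpha\wedge\mathrm{rep}_\alpha(\beta)$, where $\mathrm{rep}_\alpha(\cdot)$ is a fixed translation that replaces the non-arithmetical relation symbols in its argument with symbols of the same arity that are not present in $\alpha$ (distinct symbols being replaced by distinct symbols).
   Context: $\mathcal{L}_A$ is the first-order language with equality of signature $\langle 0,1,+,\times,<\rangle$. $\mathrm{EA}$ is (a fixed finite axiomatization of) $\mathrm{PA}^-$ (nonnegative parts of discretely ordered rings) + induction for $\Delta_0$ formulae + totality of exponentiation. All languages extend $\mathcal{L}_A$ by finitely many relation symbols. A translation from $\mathcal{L}_1$ to $\mathcal{L}_2$ sends each non-arithmetical $n$-ary relation symbol of $\mathcal{L}_1$ to an $\mathcal{L}_2$-formula with exactly $n$ free variables, is the identity on arithmetical symbols, and is extended to all formulae by commuting with connectives and (unrelativized) quantifiers. $U\lhd V$ ($U$ is definable in $V$) if for some such translation $\sigma$, $V\vdash\sigma[\alpha]$ for every axiom $\alpha$ of $U$. A theory of truth for $\mathcal{L}_A$ is a consistent theory $Th\supseteq\mathrm{EA}$ for which there is a formula $\Theta(x)$ of its language with $Th\vdash\Theta(\ulcorner\sigma\urcorner)\leftrightarrow\sigma$ for every $\mathcal{L}_A$-sentence $\sigma$. A definition of truth is a finitely axiomatizable theory of truth for $\mathcal{L}_A$,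 identified with a single sentence. $c\mathrm{DEF}$ is the set of definitions of truth that are (syntactically) conservative over $\mathrm{EA}$, i.e. every $\mathcal{L}_A$-sentence provable in them is provable in $\mathrm{EA}$. The definability order is the quotient of the pre-order $\langle c\mathrm{DEF},\lhd\rangle$ by mutual definability. *)

(* Defs.v *)
From HB Require Import structures.
From mathcomp Require Import all_boot all_order.
From mathcomp Require Import boolp classical_sets.

Set Implicit Arguments.
Unset Strict Implicit.
Unset Printing Implicit Defensive.

Local Open Scope classical_set_scope.

(* All languages share one infinite supply of non-arithmetical relation
   symbols: (n, k) is the k-th symbol of arity n.  A language is given by the
   finite list of its non-arithmetical symbols; L_A is the empty list. *)
Definition sym := (nat * nat)%type.
Definition arity (R : sym) : nat := R.1.
Definition language := seq sym.
Definition LA : language := [::].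

Inductive term :=
| Var of nat
| Zero
| One
| Add of term & term
| Mul of term & term.

(* De Bruijn indices: All and Ex bind variable 0 of their body. *)
Inductive formula :=
| Bot
| Eq of term & term
| Lt of term & term
| Rel (R : sym) of (arity R).-tuple term
| And of formula & formula
| Or of formula & formula
| Imp of formula & formula
| All of formula
| Ex of formula.

(* Classical decidable equality, which gives [A \in G] for G : seq formula. *)
HB.instance Definition _ := gen_eqMixin formula.

Definition Neg A := Imp A Bot.
Definition Iff A B := And (Imp A B) (Imp B A).
Definition Le s t := Or (Lt s t) (Eq s t).

Fixpoint free_t (i : nat) (t : term) : bool :=
  match t with
  | Var j => i == j
  | Zero | One => false
  | Add s u | Mul s u => free_t i s || free_t i u
  end.

Fixpoint free (i : nat) (A : formula) : bool :=
  match A with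
  | Bot => false
  | Eq s t | Lt s t => free_t i s || free_t i t
  | Rel R ts => has (free_t i) ts
  | And B C | Or B C | Imp B C => free i B || free i C
  | All B | Ex B => free i.+1 B
  end.

Definition sentence (A : formula) : Prop := forall i, ~~ free i A.

Fixpoint syms (A : formula) : language :=
  match A with
  | Bot | Eq _ _ | Lt _ _ => [::]
  | Rel R _ => [:: R]
  | And B C | Or B C | Imp B C => syms B ++ syms C
  | All B | Ex B => syms B
  end.

Definition formula_of (L : language) (A : formula) : Prop :=
  {subset syms A <= L}.

Definition sentence_of (L : language) (A : formula) : Prop :=
  formula_of L A /\ sentence A.

Fixpoint subst_t (s : nat -> term) (t : term) : term :=
  match t with
  | Var i => s i
  | Zero => Zero
  | One => One
  | Add u v => Add (subst_t s u) (subst_t s v)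
  | Mul u v => Mul (subst_t s u) (subst_t s v)
  end.

Definition shift (k : nat) : term -> term := subst_t (fun i => Var (k + i)).

Definition scons (t : term) (s : nat -> term) (i : nat) : term :=
  if i is j.+1 then s j else t.

Definition up (s : nat -> term) : nat -> term :=
  scons (Var 0) (fun i => shift 1 (s i)).

Fixpoint subst (s : nat -> term) (A : formula) : formula :=
  match A with
  | Bot => Bot
  | Eq t u => Eq (subst_t s t) (subst_t s u)
  | Lt t u => Lt (subst_t s t) (subst_t s u)
  | Rel R ts => Rel (map_tuple (subst_t s) ts)
  | And B C => And (subst s B) (subst s C)
  | Or B C => Or (subst s B) (subst s C)
  | Imp B C => Imp (subst s B) (subst s C)
  | All B => All (subst (up s) B)
  | Ex B => Ex (subst (up s) B)
  end.

Definition lift : formula -> formula := subst (fun i => Var i.+1).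

(* A[t]: variable 0 is replaced by t and the other variables are lowered. *)
Definition inst (A : formula) (t : term) : formula := subst (scons t Var) A.

(* Natural deduction for classical first-order logic with equality. *)
Inductive derivable : seq formula -> formula -> Prop :=
| d_hyp G A : A \in G -> derivable G A
| d_raa G A : derivable (Neg A :: G) Bot -> derivable G A
| d_andI G A B : derivable G A -> derivable G B -> derivable G (And A B)
| d_andE1 G A B : derivable G (And A B) -> derivable G A
| d_andE2 G A B : derivable G (And A B) -> derivable G B
| d_orI1 G A B : derivable G A -> derivable G (Or A B)
| d_orI2 G A B : derivable G B -> derivable G (Or A B)
| d_orE G A B C : derivable G (Or A B) -> derivable (A :: G) C ->
    derivable (B :: G) C -> derivable G C
| d_impI G A B : derivable (A :: G) B -> derivable G (Imp A B)
| d_impE G A B : derivable G (Imp A B) -> derivable G A -> derivable G B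
| d_allI G A : derivable (map lift G) A -> derivable G (All A)
| d_allE G A t : derivable G (All A) -> derivable G (inst A t)
| d_exI G A t : derivable G (inst A t) -> derivable G (Ex A)
| d_exE G A B : derivable G (Ex A) -> derivable (A :: map lift G) (lift B) ->
    derivable G B
| d_eqI G t : derivable G (Eq t t)
| d_eqE G A t u : derivable G (Eq t u) -> derivable G (inst A t) ->
    derivable G (inst A u).

(* A theory is presented by its set of axioms. *)
Definition theory := set formula.

Definition proves (T : theory) (A : formula) : Prop :=
  exists G, (forall B, B \in G -> T B) /\ derivable G A.

Definition consistent (T : theory) : Prop := ~ proves T Bot.

Definition PAminus : seq formula :=
  let x := Var 2 in let y := Var 1 in let z := Var 0 in
  let all3 A := All (All (All A)) in
  [:: all3 (Eq (Add (Add x y) z) (Add x (Add y z)));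
      all3 (Eq (Add x y) (Add y x));
      all3 (Eq (Mul (Mul x y) z) (Mul x (Mul y z)));
      all3 (Eq (Mul x y) (Mul y x));
      all3 (Eq (Mul x (Add y z)) (Add (Mul x y) (Mul x z)));
      all3 (And (Eq (Add x Zero) x) (Eq (Mul x Zero) Zero));
      all3 (Eq (Mul x One) x);
      all3 (Imp (And (Lt x y) (Lt y z)) (Lt x z));
      all3 (Neg (Lt x x));
      all3 (Or (Lt x y) (Or (Eq x y) (Lt y x)));
      all3 (Imp (Lt x y) (Lt (Add x z) (Add y z)));
      all3 (Imp (And (Lt Zero z) (Lt x y)) (Lt (Mul x z) (Mul y z)));
      All (All (Imp (Lt (Var 1) (Var 0))
                    (Ex (Eq (Add (Var 2) (Var 0)) (Var 1)))));
      And (Lt Zero One) (All (Imp (Lt Zero (Var 0)) (Le One (Var 0))));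
      All (Le Zero (Var 0))].

(* Arithmetical formulae in which all quantifiers are bounded by a term not
   containing the quantified variable. *)
Inductive Delta0 : formula -> Prop :=
| D0_bot : Delta0 Bot
| D0_eq s t : Delta0 (Eq s t)
| D0_lt s t : Delta0 (Lt s t)
| D0_and A B : Delta0 A -> Delta0 B -> Delta0 (And A B)
| D0_or A B : Delta0 A -> Delta0 B -> Delta0 (Or A B)
| D0_imp A B : Delta0 A -> Delta0 B -> Delta0 (Imp A B)
| D0_all t A : Delta0 A -> Delta0 (All (Imp (Lt (Var 0) (shift 1 t)) A))
| D0_ex t A : Delta0 A -> Delta0 (Ex (And (Lt (Var 0) (shift 1 t)) A)).

(* Induction on variable 0 of A; the other variables are parameters. *)
Definition induction (A : formula) : formula :=
  let A_succ := subst (scons (Add (Var 0) One) (fun i => Var i.+1)) A in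
  Imp (And (inst A Zero) (All (Imp A A_succ))) (All A).

(* Goedel's beta function: r is the remainder of a modulo 1 + (i + 1) b. *)
Definition beta (a b i r : term) : formula :=
  let m := Add One (Mul (Add i One) b) in
  And (Lt r m)
      (Ex (Eq (shift 1 a) (Add (Mul (Var 0) (shift 1 m)) (shift 1 r)))).

(* x ^ y = z: some beta-coded sequence starts with 1, is multiplied by x at
   each of its first y steps, and has z as its entry of index y.  (Over
   bounded induction, totality of this graph is equivalent to totality of the
   bounded definition of exponentiation: the entries of such a sequence are
   all bounded by its code, so bounded induction identifies them with powers
   of x, and conversely IDelta0 + exp proves that the code exists.) *)
Definition exp_graph (x y z : term) : formula :=
  Ex (Ex (And (beta (Var 1) (Var 0) Zero One)
         (And (All (Imp (Lt (Var 0) (shift 3 y))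
                 (Ex (And (beta (Var 3) (Var 2) (Var 1) (Var 0))
                          (beta (Var 3) (Var 2) (Add (Var 1) One)
                                (Mul (shift 4 x) (Var 0)))))))
              (beta (Var 1) (Var 0) (shift 2 y) (shift 2 z))))).

Definition exp_total : formula :=
  All (All (Ex (exp_graph (Var 2) (Var 1) (Var 0)))).

(* [iter n All A] being a sentence, it is a universal closure of A. *)
Definition EA : theory := [set A |
  [\/ A \in PAminus,
      exists n B, [/\ Delta0 B, sentence A & A = iter n All (induction B)]
    | A = exp_total]].

(* A formula is read as a word in Polish notation, and words are coded by the
   library's bijection between sequences of numbers and numbers. *)
Fixpoint word_t (t : term) : seq nat :=
  match t with
  | Var i => [:: 0; i]
  | Zero => [:: 1]
  | One => [:: 2]
  | Add s u => 3 :: word_t s ++ word_t u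
  | Mul s u => 4 :: word_t s ++ word_t u
  end.

Fixpoint word (A : formula) : seq nat :=
  match A with
  | Bot => [:: 5]
  | Eq s t => 6 :: word_t s ++ word_t t
  | Lt s t => 7 :: word_t s ++ word_t t
  | Rel R ts => [:: 8, R.1, R.2 & flatten (map word_t ts)]
  | And B C => 9 :: word B ++ word C
  | Or B C => 10 :: word B ++ word C
  | Imp B C => 11 :: word B ++ word C
  | All B => 12 :: word B
  | Ex B => 13 :: word B
  end.

Definition goedel (A : formula) : nat := CodeSeq.code (word A).

Fixpoint numeral (n : nat) : term :=
  if n is m.+1 then Add (numeral m) One else Zero.

(* Only the values on the symbols of L1 matter.  In [tau R] the i-th argument
   of R is the variable i. *)
Definition is_translation (L1 L2 : language) (tau : sym -> formula) : Prop :=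
  forall R, R \in L1 ->
    formula_of L2 (tau R) /\ (forall i, free i (tau R) = (i < arity R)).

Fixpoint translate (tau : sym -> formula) (A : formula) : formula :=
  match A with
  | Bot => Bot
  | Eq s t => Eq s t
  | Lt s t => Lt s t
  | Rel R ts => subst (fun i => nth Zero ts i) (tau R)
  | And B C => And (translate tau B) (translate tau C)
  | Or B C => Or (translate tau B) (translate tau C)
  | Imp B C => Imp (translate tau B) (translate tau C)
  | All B => All (translate tau B)
  | Ex B => Ex (translate tau B)
  end.

Definition definable (L1 : language) (U : theory) (L2 : language) (V : theory)
    : Prop :=
  exists tau, is_translation L1 L2 tau /\
    forall A, U A -> proves V (translate tau A).

Definition theory_of_truth (L : language) (T : theory) : Prop :=
  [/\ forall A, T A -> sentence_of L A,
      consistent T,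
      forall A, EA A -> proves T A &
      exists Theta, [/\ formula_of L Theta,
        forall i, free i Theta -> i = 0 &
        forall A, sentence_of LA A ->
          proves T (Iff (inst Theta (numeral (goedel A))) A)]].

Definition conservative_over_EA (T : theory) : Prop :=
  forall A, sentence_of LA A -> proves T A -> proves EA A.

(* A finitely axiomatized theory is identified with a single sentence A; its
   language consists of the symbols occurring in A. *)
Definition definition_of_truth (A : formula) : Prop :=
  theory_of_truth (syms A) [set A].

Definition is_cDEF (A : formula) : Prop :=
  definition_of_truth A /\ conservative_over_EA [set A].

Definition cDEF : Type := {A : formula | is_cDEF A}.

Definition defines (a b : cDEF) : Prop :=
  definable (syms (sval a)) [set sval a] (syms (sval b)) [set sval b].

Definition mutually_definable (a b : cDEF) : Prop := defines a b /\ defines b a.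

Definition class (a : cDEF) : set cDEF := [set b | mutually_definable a b].

(* The quotient of cDEF by mutual definability, as a set of classes. *)
Definition cDEFquo : Type := {X : set cDEF | exists a, X = class a}.

Definition cls (a : cDEF) : cDEFquo :=
  exist _ (class a) (ex_intro _ a (erefl (class a))).

Definition quo_le (X Y : cDEFquo) : Prop :=
  exists a b, [/\ sval X a, sval Y b & defines a b].

(* rho sends symbols to distinct symbols of the same arity not in A. *)
Definition fresh_renaming (A : formula) (rho : sym -> sym) : Prop :=
  [/\ forall R, arity (rho R) = arity R, injective rho &
      forall R, rho R \notin syms A].

Definition rename (rho : sym -> sym) : formula -> formula :=
  translate (fun R => Rel [tuple Var i | i < arity (rho R)]).

Lemma fresh_renaming_exists (A : formula) : exists rho, fresh_renaming A rho.
Proof.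
exists (fun R => (R.1, R.2 + (\max_(S <- syms A) S.2).+1)); split=> [//||R].
  by case=> [n k] [m l] /= [-> /addIn ->].
apply/negP => inA; have := @leq_bigmax_seq _ _ xpredT snd _ inA isT.
by rewrite /= addnS ltnNge leq_addl.
Qed.

(* Main.v *)
(** Everything but the conservativity of suprema is a matter of piecewise
    translations: if a sentence P decides which of two translations of A is
    provable, then "the first one if P, else the second one" translates A.
    With P := alpha this makes alpha \/ beta the greatest lower bound, and with
    P the two translations of alpha it gives distributivity.  Conservativity of
    alpha /\ rep(beta) follows from Craig interpolation, as the two conjuncts
    share only arithmetical symbols.  Interpolation is proved by a Henkin
    construction of a maximal inseparable pair of theories, which also yields
    completeness, so that provability can be handled semantically. *)

From HB Require Import structures.
From mathcomp Require Import all_boot all_order.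
From mathcomp Require Import boolp classical_sets.
Require Import Defs.

Set Implicit Arguments.
Unset Strict Implicit.
Unset Printing Implicit Defensive.

(** Derivations are not confined to a language, so the languages enter definability only through the
    domain and the range of the translations. A translation must give each symbol exactly the
    variables below its arity as free variables. Choosing between two translations by a sentence
    respects this, because a sentence brings in no variable; and in each model the sentence is just
    true or false, so the piecewise translation agrees there with one of its pieces.

    Conservativity here is syntactic: a model of EA need not expand to a model of alpha or of beta.
    Hence models of the two conjuncts cannot simply be merged over a common arithmetical part, and
    the consequences of the conjunction have to be split by an arithmetical interpolant. *)

HB.instance Definition _ := gen_eqMixin term.

(** * Substitution *)

Lemma subst_t_ext t s s' :
  (forall i, free_t i t -> s i = s' i) -> subst_t s t = subst_t s' t.
Proof.
elim: t => [i|||t IHt u IHu|t IHt u IHu] //= eq_s; first exact: eq_s.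
- by rewrite IHt ?IHu // => i fi; apply: eq_s; rewrite fi ?orbT.
- by rewrite IHt ?IHu // => i fi; apply: eq_s; rewrite fi ?orbT.
Qed.

Lemma subst_ext A s s' :
  (forall i, free i A -> s i = s' i) -> subst s A = subst s' A.
Proof.
elim: A s s' => [|t u|t u|R ts|A IHA B IHB|A IHA B IHB|A IHA B IHB|A IHA|A IHA]
  s s' //= eq_s.
1,2: by rewrite (@subst_t_ext t s s') ?(@subst_t_ext u s s') // => i fi;
  apply: eq_s; rewrite fi ?orbT.
- congr Rel; apply: val_inj => /=; apply/eq_in_map => t tin.
  by apply: subst_t_ext => i fi; apply: eq_s; apply/hasP; exists t.
1,2,3: by rewrite (IHA s s') ?(IHB s s') // => i fi; apply: eq_s;
  rewrite fi ?orbT.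
1,2: by rewrite (IHA (up s) (up s')) // => -[|i] //= fi; rewrite eq_s.
Qed.

Lemma subst_t_comp s r t :
  subst_t s (subst_t r t) = subst_t (fun i => subst_t s (r i)) t.
Proof. by elim: t => //= t -> u ->. Qed.

Lemma up_comp s r :
  (fun i => subst_t (up s) (up r i)) = up (fun i => subst_t s (r i)).
Proof. by apply/funext => -[|i] //=; rewrite /shift !subst_t_comp. Qed.

Lemma subst_comp s r A :
  subst s (subst r A) = subst (fun i => subst_t s (r i)) A.
Proof.
elim: A s r => [|t u|t u|R ts|A IHA B IHB|A IHA B IHB|A IHA B IHB|A IHA|A IHA]
  s r //=.
1,2: by rewrite !subst_t_comp.
- congr Rel; apply: val_inj => /=; rewrite -map_comp; apply: eq_map => t /=.
  exact: subst_t_comp.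
1,2,3: by rewrite IHA IHB.
1,2: by rewrite IHA up_comp.
Qed.

Lemma up_Var : up Var = Var.
Proof. by apply/funext => -[]. Qed.

Lemma subst_t_Var t : subst_t Var t = t.
Proof. by elim: t => //= t -> u ->. Qed.

Lemma subst_Var A : subst Var A = A.
Proof.
elim: A => [|t u|t u|R ts|A IHA B IHB|A IHA B IHB|A IHA B IHB|A IHA|A IHA] //=.
1,2: by rewrite !subst_t_Var.
- congr Rel; apply: val_inj => /=; rewrite -[RHS]map_id; apply: eq_map => t /=.
  exact: subst_t_Var.
1,2,3: by rewrite IHA IHB.
1,2: by rewrite up_Var IHA.
Qed.

Lemma inst_subst_up A s t : inst (subst (up s) A) t = subst (scons t s) A.
Proof.
rewrite /inst subst_comp; congr subst; apply/funext => -[|i] //=.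
by rewrite /shift subst_t_comp subst_t_Var.
Qed.

Lemma subst_inst A s t :
  subst s (inst A t) = inst (subst (up s) A) (subst_t s t).
Proof.
rewrite inst_subst_up /inst subst_comp; congr subst.
by apply/funext => -[].
Qed.

Lemma subst_up_lift A s : subst (up s) (lift A) = lift (subst s A).
Proof. by rewrite /lift !subst_comp. Qed.

Lemma syms_subst s A : syms (subst s A) = syms A.
Proof.
elim: A s => [|t u|t u|R ts|A IHA B IHB|A IHA B IHB|A IHA B IHB|A IHA|A IHA]
  s //=; by rewrite IHA ?IHB.
Qed.

Lemma formula_of_subst L s A : formula_of L (subst s A) <-> formula_of L A.
Proof. by rewrite /formula_of syms_subst. Qed.

Lemma formula_of_cat L A B C : syms C = syms A ++ syms B ->
  formula_of L C <-> formula_of L A /\ formula_of L B.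
Proof.
rewrite /formula_of => ->; split=> [sub|[subA subB] R].
  by split=> R inR; apply: sub; rewrite mem_cat inR ?orbT.
by rewrite mem_cat => /orP[/subA|/subB].
Qed.

Lemma free_t_subst i s t :
  free_t i (subst_t s t) <-> exists2 j, free_t j t & free_t i (s j).
Proof.
elim: t => [k|||t IHt u IHu|t IHt u IHu] /=; [| by split=> // -[] ..| |].
- by split=> [fi|[j /eqP -> //]]; exists k.
all: split.
1,3: by case/orP=> [/IHt|/IHu] [j fj fi]; exists j => //; rewrite fj ?orbT.
all: case=> j /orP[fj|fj] fi; apply/orP;
  by [left; apply/IHt; exists j|right; apply/IHu; exists j].
Qed.

Lemma free_subst i s A :
  free i (subst s A) <-> exists2 j, free j A & free_t i (s j).
Proof.
elim: A i s => [|t u|t u|R ts|A IHA B IHB|A IHA B IHB|A IHA B IHB|A IHA|A IHA]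
  i s /=.
- by split=> // -[].
1,2: split=> [/orP[]/free_t_subst[j fj fi]|[j /orP[fj|fj] fi]];
  try (by exists j => //; rewrite fj ?orbT);
  apply/orP; by [left; apply/free_t_subst; exists j
                |right; apply/free_t_subst; exists j].
- split=> [/hasP[_ /mapP[t tin ->]] /free_t_subst[j fj fi]|[j /hasP[t tin fj] fi]].
    by exists j => //; apply/hasP; exists t.
  apply/hasP; exists (subst_t s t); first exact: map_f.
  by apply/free_t_subst; exists j.
1,2,3: split=> [/orP[/IHA|/IHB][j fj fi]|[j /orP[fj|fj] fi]];
  try (by exists j => //; rewrite fj ?orbT);
  apply/orP; by [left; apply/IHA; exists j|right; apply/IHB; exists j].
1,2: split=> [/IHA[[|j] //= fj /free_t_subst[k fk]]|[j fj fi]];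
  first (by rewrite /= add1n eqSS => /eqP ->; exists j);
  apply/IHA; exists j.+1 => //=; apply/free_t_subst; exists i => //=;
  by rewrite add1n.
Qed.

(** Supplies the variables that will act as fresh Henkin constants. *)
Lemma free_bounded A : exists k, forall i, k <= i -> ~~ free i A.
Proof.
have bt t : exists k, forall i, k <= i -> ~~ free_t i t.
  elim: t => [j|||t [k Hk] u [l Hl]|t [k Hk] u [l Hl]]; try by exists 0.
  - by exists j.+1 => i /= ji; rewrite neq_ltn ji orbT.
  1,2: by exists (maxn k l) => i /=; rewrite geq_max => /andP[/Hk/negPf -> /Hl].
elim: A => [|t u|t u|R ts|A [k Hk] B [l Hl]|A [k Hk] B [l Hl]|A [k Hk] B [l Hl]
  |A [k Hk]|A [k Hk]]; first by exists 0.
1,2: have [[k Hk] [l Hl]] := (bt t, bt u);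
  by exists (maxn k l) => i /=; rewrite geq_max => /andP[/Hk/negPf -> /Hl].
- case: ts => ts sz /=; elim: ts {sz} => [|t ts [l Hl]]; first by exists 0.
  have [k Hk] := bt t.
  by exists (maxn k l) => i /=; rewrite geq_max => /andP[/Hk/negPf -> /Hl].
1,2,3: by exists (maxn k l) => i /=; rewrite geq_max => /andP[/Hk/negPf -> /Hl].
1,2: by exists k => i ki /=; rewrite Hk // leqW.
Qed.

(** * Derivations *)

Lemma derivable_weaken G G' A : {subset G <= G'} ->
  derivable G A -> derivable G' A.
Proof.
move=> sub d; elim: d G' sub => {G A}
  [G A inG|G A _ IH|G A B _ IHA _ IHB|G A B _ IH|G A B _ IH|G A B _ IH
  |G A B _ IH|G A B C _ IH _ IHA _ IHB|G A B _ IH|G A B _ IHA _ IHB|G A _ IH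
  |G A t _ IH|G A t _ IH|G A B _ IHA _ IHB|G t|G A t u _ IHt _ IHA] G' sub.
- by apply: d_hyp; apply: sub.
- apply: d_raa; apply: IH => B; rewrite !inE => /orP[-> //|/sub ->].
  by rewrite orbT.
- by apply: d_andI; [apply: IHA|apply: IHB].
- by apply: d_andE1; apply: IH sub.
- by apply: d_andE2; apply: IH sub.
- by apply: d_orI1; apply: IH.
- by apply: d_orI2; apply: IH.
- apply: d_orE (IH _ sub) _ _; [apply: IHA|apply: IHB] => D;
    by rewrite !inE => /orP[-> //|/sub ->]; rewrite orbT.
- apply: d_impI; apply: IH => D.
  by rewrite !inE => /orP[-> //|/sub ->]; rewrite orbT.
- exact: d_impE (IHA _ sub) (IHB _ sub).
- apply: d_allI; apply: IH => _ /mapP[B inB ->]; exact/map_f/sub.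
- by apply: d_allE; apply: IH.
- by apply: d_exI; apply: IH.
- apply: d_exE (IHA _ sub) _; apply: IHB => D; rewrite !inE => /orP[-> //|].
  by case/mapP=> C inC ->; rewrite map_f ?orbT //; apply: sub.
- exact: d_eqI.
- exact: d_eqE (IHt _ sub) (IHA _ sub).
Qed.

(** The eigenvariable conditions are expressed by [lift], which commutes with substitution, so every
    rule is preserved. The use of this is to turn a Henkin constant into a variable that can be
    quantified. *)
Lemma derivable_subst s G A :
  derivable G A -> derivable (map (subst s) G) (subst s A).
Proof.
have lift_map r H : map lift (map (subst r) H) = map (subst (up r)) (map lift H).
  by rewrite -!map_comp; apply: eq_map => B /=; rewrite subst_up_lift.
move=> d; elim: d s => {G A}
  [G A inG|G A _ IH|G A B _ IHA _ IHB|G A B _ IH|G A B _ IH|G A B _ IH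
  |G A B _ IH|G A B C _ IH _ IHA _ IHB|G A B _ IH|G A B _ IHA _ IHB|G A _ IH
  |G A t _ IH|G A t _ IH|G A B _ IHA _ IHB|G t|G A t u _ IHt _ IHA] s /=.
- by apply: d_hyp; apply: map_f.
- by apply: d_raa; apply: IH.
- by apply: d_andI; [apply: IHA|apply: IHB].
- exact: d_andE1 (IH s).
- exact: d_andE2 (IH s).
- exact: d_orI1 (IH s).
- exact: d_orI2 (IH s).
- exact: d_orE (IH s) (IHA s) (IHB s).
- exact: d_impI (IH s).
- exact: d_impE (IHA s) (IHB s).
- by apply: d_allI; rewrite lift_map; apply: IH.
- by rewrite subst_inst; apply: d_allE; apply: IH.
- by apply: (@d_exI _ _ (subst_t s t)); rewrite -subst_inst; apply: IH.
- by apply: d_exE (IHA s) _; rewrite -subst_up_lift lift_map; apply: IHB.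
- exact: d_eqI.
- rewrite subst_inst; apply: d_eqE (IHt s) _; rewrite -subst_inst; exact: IHA.
Qed.

Lemma derivable_hd G A : derivable (A :: G) A.
Proof. by apply: d_hyp; rewrite mem_head. Qed.

Lemma derivable_cons B G A : derivable G A -> derivable (B :: G) A.
Proof. by apply: derivable_weaken => C inC; rewrite inE inC orbT. Qed.

Lemma derivable_exfalso G A : derivable G Bot -> derivable G A.
Proof. by move=> d; apply: d_raa; apply: derivable_cons. Qed.

Lemma derivable_em G A : derivable G (Or A (Neg A)).
Proof.
apply: d_raa; apply: d_impE (derivable_hd _ _) _; apply: d_orI2; apply: d_impI.
apply: d_impE (derivable_cons _ (derivable_hd _ _)) _.
by apply: d_orI1; apply: derivable_hd.
Qed.

(** * Term models *)

(* Structures whose elements are all terms (with the function symbols acting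
   freely) are enough here; they are given by the set M of the atomic formulae
   that they satisfy when each variable denotes itself, and equality is only
   required to be a congruence. *)
Fixpoint sat (M : set formula) (s : nat -> term) (A : formula) : Prop :=
  match A with
  | Bot => False
  | Eq _ _ | Lt _ _ | Rel _ _ => M (subst s A)
  | And B C => sat M s B /\ sat M s C
  | Or B C => sat M s B \/ sat M s C
  | Imp B C => sat M s B -> sat M s C
  | All B => forall t, sat M (scons t s) B
  | Ex B => exists t, sat M (scons t s) B
  end.

Definition atomic (A : formula) : bool :=
  match A with Eq _ _ | Lt _ _ | Rel _ _ => true | _ => false end.

Definition model (M : set formula) : Prop :=
  (forall t, M (Eq t t)) /\
  forall A t u, atomic A -> M (Eq t u) -> M (inst A t) -> M (inst A u).

Lemma sat_ext M A s s' : (forall i, free i A -> s i = s' i) ->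
  sat M s A = sat M s' A.
Proof.
elim: A s s' => [|t u|t u|R ts|A IHA B IHB|A IHA B IHB|A IHA B IHB|A IHA|A IHA]
  s s' eq_s; try (by congr M; apply: subst_ext); first by [].
1,2,3: by rewrite /= (IHA s s') ?(IHB s s') // => i fi; apply: eq_s;
  rewrite /= fi ?orbT.
- by apply: eq_forall => t; apply: IHA => -[|i] //= fi; rewrite eq_s.
- by apply: eq_exists => t; apply: IHA => -[|i] //= fi; rewrite eq_s.
Qed.

Lemma sat_sentence M A s s' : sentence A -> sat M s A = sat M s' A.
Proof. by move=> sA; apply: sat_ext => i fi; have := sA i; rewrite fi. Qed.

Lemma sat_subst M s r A :
  sat M s (subst r A) = sat M (fun i => subst_t s (r i)) A.
Proof.
have scons_comp s' r' t : (fun i => subst_t (scons t s') (up r' i)) =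
    scons t (fun i => subst_t s' (r' i)).
  by apply/funext => -[|i] //=; rewrite /shift subst_t_comp.
elim: A s r => [|t u|t u|R ts|A IHA B IHB|A IHA B IHB|A IHA B IHB|A IHA|A IHA]
  s r; first by [].
- exact: (congr1 M (subst_comp s r (Eq t u))).
- exact: (congr1 M (subst_comp s r (Lt t u))).
- exact: (congr1 M (subst_comp s r (Rel ts))).
1,2,3: by rewrite /= IHA ?IHB.
- by apply: eq_forall => t; rewrite -scons_comp; apply: IHA.
- by apply: eq_exists => t; rewrite -scons_comp; apply: IHA.
Qed.

Lemma sat_inst M s A t : sat M s (inst A t) = sat M (scons (subst_t s t) s) A.
Proof. by rewrite sat_subst; congr sat; apply/funext => -[]. Qed.

Lemma sat_lift M s t A : sat M (scons t s) (lift A) = sat M s A.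
Proof. by rewrite sat_subst. Qed.

Lemma model_sym M t u : model M -> M (Eq t u) -> M (Eq u t).
Proof.
move=> [refl congM] Mtu.
have := congM (Eq (Var 0) (shift 1 t)) t u isT Mtu.
rewrite /inst /= /shift !subst_t_comp /= subst_t_Var; apply; exact: refl.
Qed.

(** Extends the congruence property from atomic to all formulae. The parameter [r] lets the
    induction pass a quantifier: the value [x] of the new variable is absorbed into [r] as
    [shift 1 x], on which the replacement of variable 0 has no effect. *)
Lemma sat_congr M t u A r : model M -> M (Eq t u) ->
  sat M (fun i => subst_t (scons t Var) (r i)) A =
  sat M (fun i => subst_t (scons u Var) (r i)) A.
Proof.
move=> modM Mtu; have Mut := model_sym modM Mtu; have [_ congM] := modM.
have scons_inst x v r' : scons x (fun i => subst_t (scons v Var) (r' i)) =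
    fun i => subst_t (scons v Var) (scons (shift 1 x) r' i).
  by apply/funext => -[|i] //=; rewrite /shift subst_t_comp subst_t_Var.
have atom B r' : atomic B ->
    M (subst (fun i => subst_t (scons t Var) (r' i)) B) =
    M (subst (fun i => subst_t (scons u Var) (r' i)) B).
  move=> aB; rewrite -!subst_comp; apply/propext.
  by split; apply: congM => //; case: B aB.
elim: A r => [|a b|a b|R ts|A IHA B IHB|A IHA B IHB|A IHA B IHB|A IHA|A IHA] r;
  try (exact: atom); first by [].
1,2,3: by rewrite /= IHA IHB.
- by apply: eq_forall => x; rewrite !scons_inst.
- by apply: eq_exists => x; rewrite !scons_inst.
Qed.

Lemma soundness M s G A : model M -> derivable G A ->
  (forall B, B \in G -> sat M s B) -> sat M s A.
Proof.
move=> modM d.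
have cons_sat r B H : sat M r B -> (forall C, C \in H -> sat M r C) ->
    forall C, C \in B :: H -> sat M r C.
  by move=> satB satH C; rewrite inE => /orP[/eqP ->|/satH].
have lift_sat r t H : (forall C, C \in H -> sat M r C) ->
    forall C, C \in map lift H -> sat M (scons t r) C.
  by move=> satH _ /mapP[C inC ->]; rewrite sat_lift; apply: satH.
elim: d s => {G A}
  [G A inG|G A _ IH|G A B _ IHA _ IHB|G A B _ IH|G A B _ IH|G A B _ IH
  |G A B _ IH|G A B C _ IH _ IHA _ IHB|G A B _ IH|G A B _ IHA _ IHB|G A _ IH
  |G A t _ IH|G A t _ IH|G A B _ IHA _ IHB|G t|G A t u _ IHt _ IHA] s satG.
- exact: satG.
- by apply: contrapT => nA; apply: (IH s); apply: cons_sat.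
- by split; [apply: IHA|apply: IHB].
- by case: (IH s satG).
- by case: (IH s satG).
- by left; apply: IH.
- by right; apply: IH.
- by case: (IH s satG) => H; [apply: IHA|apply: IHB]; apply: cons_sat.
- by move=> H; apply: IH; apply: cons_sat.
- exact: (IHA s satG) (IHB s satG).
- by move=> t; apply: IH; apply: lift_sat.
- by rewrite sat_inst; apply: IH.
- by exists (subst_t s t); rewrite -sat_inst; apply: IH.
- have [t satt] := IHA s satG; rewrite -(sat_lift _ _ t); apply: IHB.
  by apply: cons_sat => //; apply: lift_sat.
- by case: modM => refl _; apply: refl.
- have := IHA s satG; rewrite !sat_inst.
  have E v : scons v s = fun i => subst_t (scons v Var) (up s i).
    by apply/funext => -[|i] //=; rewrite /shift subst_t_comp subst_t_Var.
  by rewrite !E (sat_congr _ _ modM (IHt s satG)).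
Qed.

(** * Craig interpolation *)

(** Terms and formulae are embedded into a countable type in order to be enumerated. An injection is
    enough, since stage [n] of the Henkin construction only asks whether some formula has code
    [n]. *)
Fixpoint tree_t (t : term) : GenTree.tree nat :=
  match t with
  | Var i => GenTree.Leaf i
  | Zero => GenTree.Node 0 [::]
  | One => GenTree.Node 1 [::]
  | Add u v => GenTree.Node 2 [:: tree_t u; tree_t v]
  | Mul u v => GenTree.Node 3 [:: tree_t u; tree_t v]
  end.

Fixpoint tree (A : formula) : GenTree.tree nat :=
  match A with
  | Bot => GenTree.Node 0 [::]
  | Eq t u => GenTree.Node 1 [:: tree_t t; tree_t u]
  | Lt t u => GenTree.Node 2 [:: tree_t t; tree_t u]
  | Rel R ts => GenTree.Node 3
      [:: GenTree.Leaf R.1, GenTree.Leaf R.2 & map tree_t ts]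
  | And B C => GenTree.Node 4 [:: tree B; tree C]
  | Or B C => GenTree.Node 5 [:: tree B; tree C]
  | Imp B C => GenTree.Node 6 [:: tree B; tree C]
  | All B => GenTree.Node 7 [:: tree B]
  | Ex B => GenTree.Node 8 [:: tree B]
  end.

Lemma tree_t_inj : injective tree_t.
Proof.
elim=> [i|||t IHt u IHu|t IHt u IHu] [j|||v w|v w] //= [].
- by move=> ->.
1,2: by move=> /IHt -> /IHu ->.
Qed.

Lemma tree_inj : injective tree.
Proof.
elim=> [|t u|t u|R ts|A IHA B IHB|A IHA B IHB|A IHA B IHB|A IHA|A IHA]
  [|v w|v w|S us|C D|C D|C D|C|C] //= [].
1,2: by move=> /tree_t_inj -> /tree_t_inj ->.
- case: R S ts us => [R1 R2] [S1 S2] ts us /= ? ?; subst => /(inj_map tree_t_inj).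
  by move/val_inj ->.
1,2,3: by move=> /IHA -> /IHB ->.
1,2: by move=> /IHA ->.
Qed.

(* Variables serve as Henkin constants; this renaming turns the constant k into
   the variable 0 that is about to be quantified. *)
Definition abstract (k i : nat) : term := if i == k then Var 0 else Var i.+1.

Lemma subst_abstract k A : ~~ free k A -> subst (abstract k) A = lift A.
Proof.
move=> nfk; apply: subst_ext => i fi; rewrite /abstract.
by case: eqP fi nfk => // -> ->.
Qed.

Lemma subst_abstract_inst k A :
  ~~ free k.+1 A -> subst (abstract k) (inst A (Var k)) = A.
Proof.
move=> nfk; rewrite /inst subst_comp -[RHS]subst_Var; apply: subst_ext.
move=> [|i] fi /=; rewrite /abstract ?eqxx //.
by case: eqP fi nfk => // -> ->.
Qed.

Lemma map_subst_abstract k G : (forall A, A \in G -> ~~ free k A) ->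
  map (subst (abstract k)) G = map lift G.
Proof. by move=> nfk; apply/eq_in_map => A /nfk /subst_abstract. Qed.

(** Lets a quantifier be introduced right after a context has been lifted: the new variable 0 is
    itself the witness for the lifted body. *)
Lemma inst_lift_up A : inst (subst (up (fun i => Var i.+1)) A) (Var 0) = A.
Proof.
by rewrite inst_subst_up -[RHS]subst_Var; congr subst; apply/funext => -[].
Qed.

(** * Inseparable pairs of finite sets of formulae *)

Section Interpolation.
Variable L : bool -> language.

(** A separating formula has to be arithmetical but may have free variables: Henkin constants are
    variables, and these are common to both sides. *)
Definition insep (X : bool -> seq formula) : Prop :=
  forall I, formula_of LA I -> derivable (X true) I ->
    derivable (X false) (Neg I) -> False.

(** Passing from [I] to [Neg I] exchanges the two sides, so later arguments treat one side [b]
    only. *)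
Lemma insep_sym X b I : insep X -> formula_of LA I ->
  derivable (X b) I -> derivable (X (~~ b)) (Neg I) -> False.
Proof.
case: b => insX LI dI dnI; first exact: insX dI dnI.
apply: (insX (Neg I)) dnI _ => [R|].
  by rewrite /= cats0; apply: LI.
apply: d_impI; apply: d_impE (derivable_hd _ _) _; exact: derivable_cons.
Qed.

Lemma separation b X : ~ insep X -> exists I,
  [/\ formula_of LA I, derivable (X b) I & derivable (X (~~ b)) (Neg I)].
Proof.
move=> ninsX; apply: contrapT => noI; apply: ninsX => I LI dI dnI.
apply: noI; case: b; [by exists I|exists (Neg I); split=> //].
  by move=> R; rewrite /= cats0; apply: LI.
apply: d_impI; apply: d_impE (derivable_hd _ _) _; exact: derivable_cons.
Qed.

Lemma insep_sub X Y : (forall b, {subset X b <= Y b}) -> insep Y -> insep X.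
Proof.
by move=> sub insY I LI dI dnI; apply: (insY I LI);
  apply: derivable_weaken (sub _) _.
Qed.

Definition upd b B (X : bool -> seq formula) c :=
  if c == b then B :: X c else X c.

Lemma sub_upd b B X c : {subset X c <= upd b B X c}.
Proof. by move=> C; rewrite /upd; case: eqP => // _; rewrite inE orbC => ->. Qed.

Lemma mem_upd b B X : B \in upd b B X b.
Proof. by rewrite /upd eqxx mem_head. Qed.

(** Suppose that [I] separates after the witness is added, and let [J] be [I] with the constant [k]
    turned into a variable. Then [Ex J] separates already before: side [b] derives it from [Ex C],
    and the other side, which does not mention [k], refutes [J] for an arbitrary value. *)
Lemma insep_witness b C k X : (forall c A, A \in X c -> ~~ free k A) ->
  Ex C \in X b -> insep X -> insep (upd b (inst C (Var k)) X).
Proof.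
move=> nfk exC insX; apply: contrapT => /(separation b)[I [LI]].
rewrite {1}/upd eqxx {1}/upd; have -> : (~~ b == b) = false by case: (b).
move=> /(derivable_subst (abstract k)) dI /(derivable_subst (abstract k)) dnI.
rewrite /= subst_abstract_inst ?(nfk _ _ exC) // in dI.
- rewrite map_subst_abstract in dI; last exact: nfk.
  rewrite map_subst_abstract /= in dnI; last exact: nfk.
  set J := subst _ I in dI dnI.
  apply: (@insep_sym X b (Ex J)) => //.
  + by apply/(formula_of_subst _ (abstract k) I).
  + apply: d_exE (d_hyp exC) _.
    by apply: (@d_exI _ _ (Var 0)); rewrite inst_lift_up.
  + apply: d_impI; apply: d_exE (derivable_hd _ _) _.
    apply: d_impE (derivable_hd _ _); apply: derivable_cons.
    exact: derivable_cons.
Qed.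

Definition good (X : bool -> seq formula) : Prop :=
  (forall b A, A \in X b -> formula_of (L b) A) /\ insep X.

(** The code [n] determines both the side and the formula, so a stage treats at most one pair. The
    formula is added if this keeps the sides inseparable, and an existential one is given its
    witness at once. *)
Lemma henkin_step n X : good X -> exists Y, [/\ good Y,
  forall b, {subset X b <= Y b} &
  forall b B, pickle (b, tree B) = n -> formula_of (L b) B ->
    insep (upd b B X) ->
    B \in Y b /\ forall C, B = Ex C -> exists k, inst C (Var k) \in Y b].
Proof.
move=> [LX insX].
have [[b [B [nE LB insU]]]|none] := pselect (exists b B,
  [/\ pickle (b, tree B) = n, formula_of (L b) B & insep (upd b B X)]); last first.
  exists X; split=> [//|b A //|b B nE LB insU]; case: none; by exists b, B.
have uniqB b' B' : pickle (b', tree B') = n -> b' = b /\ B' = B.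
  by rewrite -nE => /(pcan_inj pickleK)[-> /tree_inj ->].
have goodU : good (upd b B X).
  split=> // c A; rewrite /upd; case: eqP => [->|_]; last exact: LX.
  by rewrite inE => /orP[/eqP ->|/LX].
have [[C BE]|nEx] := pselect (exists C, B = Ex C); last first.
  exists (upd b B X); split=> // [c|b' B' /uniqB[-> ->] _ _]; first exact: sub_upd.
  by split=> [|C BE]; [exact: mem_upd|case: nEx; exists C].
have [k nfk] : exists k, forall c A, A \in upd b B X c -> ~~ free k A.
  have bound (G : seq formula) :
      exists k, forall A i, A \in G -> k <= i -> ~~ free i A.
    elim: G => [|A G [k Hk]]; first by exists 0.
    have [l Hl] := free_bounded A; exists (maxn k l) => D i.
    rewrite inE geq_max => /orP[/eqP ->|DG] /andP[ki li]; first exact: Hl.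
    exact: Hk.
  have [k1 H1] := bound (upd b B X true); have [k2 H2] := bound (upd b B X false).
  exists (maxn k1 k2) => -[] A inA; [apply: H1 inA _|apply: H2 inA _].
    exact: leq_maxl.
  exact: leq_maxr.
exists (upd b (inst C (Var k)) (upd b B X)); split.
- split=> [c A|].
    rewrite {1}/upd; case: eqP => [->|_]; last by case: goodU => H _; apply: H.
    rewrite inE => /orP[/eqP ->|]; last by case: goodU => H _; apply: H.
    by apply/formula_of_subst; move: LB; rewrite BE.
  by apply: insep_witness => //; rewrite -BE; apply: mem_upd.
- by move=> c A inA; do 2!apply: sub_upd.
- move=> b' B' /uniqB[-> ->] _ _; split=> [|C']; first exact/sub_upd/mem_upd.
  by rewrite BE => -[<-]; exists k; apply: mem_upd.
Qed.

(** * Saturation of an inseparable pair, and its model *)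

Section Henkin.
Variable X0 : bool -> seq formula.
Hypothesis good0 : good X0.

Lemma henkin_sequence : exists X : nat -> bool -> seq formula,
  [/\ X 0 = X0, forall n, good (X n),
    forall n b, {subset X n b <= X n.+1 b} &
    forall n b B, pickle (b, tree B) = n -> formula_of (L b) B ->
      insep (upd b B (X n)) -> B \in X n.+1 b /\
      forall C, B = Ex C -> exists k, inst C (Var k) \in X n.+1 b].
Proof.
pose state := {X | good X}.
have next (p : nat * state) : exists Y : state,
    (forall b, {subset sval p.2 b <= sval Y b}) /\
    forall b B, pickle (b, tree B) = p.1 -> formula_of (L b) B ->
      insep (upd b B (sval p.2)) -> B \in sval Y b /\
      forall C, B = Ex C -> exists k, inst C (Var k) \in sval Y b.
  case: p => n [X gX]; have [Y [gY sub wit]] := henkin_step n gX.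
  by exists (exist _ Y gY).
have [f Hf] := choice next.
pose X := fix X n : state := if n is m.+1 then f (m, X m) else exist _ X0 good0.
exists (fun n => sval (X n)); split=> // n.
- exact: (svalP (X n)).
- by case: (Hf (n, X n)).
- by case: (Hf (n, X n)).
Qed.

(** Derivations use finitely many hypotheses, so the limit inherits inseparability from the stages.
    It decides each formula of its side: if neither [A] nor [Neg A] could be added, with separators
    [I] and [J], then excluded middle for [A] makes side [b] derive [Or I J], while the other side
    refutes both disjuncts. *)
Lemma henkin : exists D : bool -> set formula,
  [/\ forall b A, A \in X0 b -> D b A,
    forall b A, D b A -> formula_of (L b) A,
    forall b (G H : seq formula) I, (forall A, A \in G -> D b A) ->
      (forall A, A \in H -> D (~~ b) A) -> formula_of LA I ->
      derivable G I -> derivable H (Neg I) -> False,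
    forall b A, formula_of (L b) A -> D b A \/ D b (Neg A) &
    forall b C, D b (Ex C) -> exists k, D b (inst C (Var k))].
Proof.
have [X [X0E gX subX witX]] := henkin_sequence.
have mono m n b : m <= n -> {subset X m b <= X n b}.
  move=> mn; rewrite -(subnKC mn); elim: (n - m) => [|d IH] A inA.
    by rewrite addn0.
  by rewrite addnS; apply: subX; apply: IH.
pose D b : set formula := fun A => exists n, A \in X n b.
have fin b (G : seq formula) :
    (forall A, A \in G -> D b A) -> exists n, {subset G <= X n b}.
  elim: G => [|A G IH] DG; first by exists 0.
  have [n nA] := DG A (mem_head _ _).
  have [|m mG] := IH; first by move=> B inB; apply: DG; rewrite inE inB orbT.
  exists (maxn n m) => B; rewrite inE => /orP[/eqP ->|/mG].
    exact: mono (leq_maxl _ _) _ nA.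
  exact: mono (leq_maxr _ _) _.
have nosep b (G H : seq formula) I : (forall A, A \in G -> D b A) ->
    (forall A, A \in H -> D (~~ b) A) -> formula_of LA I ->
    derivable G I -> derivable H (Neg I) -> False.
  move=> /fin[n subG] /fin[m subH] LI dI dnI.
  apply: (@insep_sym (X (maxn n m)) b I) => //; first by case: (gX (maxn n m)).
    by apply: derivable_weaken dI => A /subG; apply: mono (leq_maxl _ _) _.
  by apply: derivable_weaken dnI => A /subH; apply: mono (leq_maxr _ _) _.
exists D; split=> //.
- by move=> b A inA; exists 0; rewrite X0E.
- by move=> b A [n inA]; case: (gX n) => LX _; apply: LX inA.
- move=> b A LA; apply: contrapT => /not_orP[nA nnA].
  have add B : formula_of (L b) B -> ~ D b B -> exists n I,
      [/\ formula_of Defs.LA I, derivable (B :: X n b) I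
        & derivable (X n (~~ b)) (Neg I)].
    move=> LB nB; pose n := pickle (b, tree B); exists n.
    have /(separation b)[I] : ~ insep (upd b B (X n)).
      move=> /(witX _ _ _ erefl LB)[inB _]; apply: nB; by exists n.+1.
    rewrite /upd eqxx; have -> : (~~ b == b) = false by case: (b).
    by exists I.
  have [n [I [LI dI dnI]]] := add A LA nA.
  have LnA : formula_of (L b) (Neg A) by move=> R; rewrite /= cats0; apply: LA.
  have [m [J [LJ dJ dnJ]]] := add _ LnA nnA.
  apply: (@nosep b (X n b ++ X m b) (X n (~~ b) ++ X m (~~ b)) (Or I J)).
  + by move=> B; rewrite mem_cat => /orP[]; [exists n|exists m].
  + by move=> B; rewrite mem_cat => /orP[]; [exists n|exists m].
  + by move=> R; rewrite /= mem_cat => /orP[/LI|/LJ].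
  + apply: d_orE (derivable_em _ A) _ _.
      apply: d_orI1; apply: derivable_weaken dI => B.
      by rewrite !inE mem_cat => /orP[->|->] //; rewrite orbT.
    apply: d_orI2; apply: derivable_weaken dJ => B.
    by rewrite !inE mem_cat => /orP[->|->] //; rewrite !orbT.
  + apply: d_impI; apply: d_orE (derivable_hd _ _) _ _.
      apply: d_impE (derivable_hd _ _); do 2!apply: derivable_cons.
      by apply: derivable_weaken dnI => B; rewrite mem_cat => ->.
    apply: d_impE (derivable_hd _ _); do 2!apply: derivable_cons.
    by apply: derivable_weaken dnJ => B; rewrite mem_cat => ->; rewrite orbT.
(* [Ex C] may have entered at a stage [n] other than its own stage [m]. Adding it at stage [m] is
   harmless, because the result is contained in stage [maxn m n]; so a witness is provided at stage
   [m]. *)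
- move=> b C [n inC]; pose m := pickle (b, tree (Ex C)).
  have [||_ /(_ C erefl)[k inCk]] := witX m b (Ex C) erefl.
  + by case: (gX n) => LX _; apply: LX inC.
  + apply: (@insep_sub _ (X (maxn m n))); last by case: (gX (maxn m n)).
    move=> c B; rewrite /upd; case: eqP => [->|_ inB].
      rewrite inE => /orP[/eqP ->|inB]; last exact: mono (leq_maxl _ _) _ inB.
      exact: mono (leq_maxr _ _) _ inC.
    exact: mono (leq_maxl _ _) _ inB.
  + by exists k, m.+1.
Qed.

Hypothesis disjointL : forall R, R \in L true -> R \notin L false.

(** The two theories agree on arithmetical formulae, for otherwise one of these would separate them,
    and they share no other symbol. So the union of the two restricts on atomic formulae to either
    theory, and the truth lemma can be proved for both sides at once. *)
Lemma insep_model : exists M, model M /\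
  forall b A, A \in X0 b -> sat M Var A.
Proof.
have [D [D0 DL nosep complete wit]] := henkin.
have closed b (G : seq formula) A : (forall B, B \in G -> D b B) -> formula_of (L b) A ->
    derivable G A -> D b A.
  move=> DG LA dA; case: (complete b A LA) => // DnA.
  case: (nosep b (Neg A :: G) [::] Bot) => //.
  - by move=> B; rewrite inE => /orP[/eqP ->|/DG].
  - by apply: d_impE (derivable_hd _ _) _; apply: derivable_cons.
  - by apply: d_impI; apply: derivable_hd.
have closed1 b A B : formula_of (L b) B -> derivable [:: A] B -> D b A -> D b B.
  by move=> LB d DA; apply: closed d => // C; rewrite inE => /eqP ->.
have closed2 b A B C : formula_of (L b) C -> derivable [:: A; B] C ->
    D b A -> D b B -> D b C.
  move=> LC d DA DB; apply: closed d => // E; rewrite !inE.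
  by case/orP=> /eqP ->.
have consis b A : D b A -> ~ D b (Neg A).
  move=> DA DnA; have DBot : D b Bot.
    apply: closed2 DnA DA => //; apply: d_impE (derivable_hd _ _) _.
    by apply: derivable_cons; apply: derivable_hd.
  apply: (nosep b [:: Bot] [::] Bot) => //.
  - by move=> B; rewrite inE => /eqP ->.
  - exact: derivable_hd.
  - by apply: d_impI; apply: derivable_hd.
have agree b A : formula_of LA A -> D b A -> D (~~ b) A.
  move=> LA DA; case: (complete (~~ b) A) => // [R /LA //|DnA].
  case: (nosep b [:: A] [:: Neg A] A) => //; try exact: derivable_hd.
  - by move=> B; rewrite inE => /eqP ->.
  - by move=> B; rewrite inE => /eqP ->.
pose M : set formula := fun A => D true A \/ D false A.
have DM b A : atomic A -> formula_of (L b) A -> M A = D b A.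
  move=> aA LA; apply/propext; split; last by case: b {LA} => DA; [left|right].
  suff tr c : D c A -> c = ~~ b -> D b A.
    by case: b LA tr => _ tr [] DA //; apply: tr DA _.
  move=> DA cE; rewrite -(negbK b) -cE; apply: agree => //.
  case: A aA LA DA => // R ts _ /(_ R (mem_head _ _)) LR /DL.
  move=> /(_ R (mem_head _ _)); rewrite cE.
  case: b LR {cE} => /= LR LR'; first by rewrite (negPf (disjointL LR)) in LR'.
  by rewrite (negPf (disjointL LR')) in LR.
exists M; split.
  split=> [t|A t u aA Mtu]; first by left; apply: (@closed _ [::]) => //; apply: d_eqI.
  have DE b : D b (Eq t u) by rewrite -DM //.
  have tr b : D b (inst A t) -> D b (inst A u).
    move=> DA; apply: closed2 (DE b) (DA).
      by move/DL: (DA) => /formula_of_subst LA; apply/formula_of_subst.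
    apply: d_eqE (derivable_hd _ _) _.
    by apply: derivable_cons; apply: derivable_hd.
  by case=> /tr; [left|right].
suff truth b A s : formula_of (L b) A -> sat M s A <-> D b (subst s A).
  by move=> b A /D0 DA; apply/(truth b); [exact: DL DA|rewrite subst_Var].
elim: A s => [|t u|t u|R ts|A IHA B IHB|A IHA B IHB|A IHA B IHB|A IHA|A IHA] s LF.
- split=> // DBot; apply: (consis b Bot) => //.
  by apply: (@closed _ [::]) => //; apply: d_impI; apply: derivable_hd.
1,2,3: by rewrite -DM //; apply/formula_of_subst.
1,2,3: have /(@formula_of_cat _ A B)[] // := LF; move=> LA LB;
  have LsA : formula_of (L b) (subst s A) by apply/formula_of_subst.
1,2,3: have LsB : formula_of (L b) (subst s B) by apply/formula_of_subst.
1,2,3: have {IHA IHB} [IHA IHB] := (IHA s LA, IHB s LB).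
1,2,3: have LsF := iffRL (formula_of_subst (L b) s _) LF; rewrite /= in LsF *.
- rewrite IHA IHB; split=> [[]|DAB].
    apply: closed2 => //; apply: d_andI; first exact: derivable_hd.
    by apply: derivable_cons; apply: derivable_hd.
  split; apply: closed1 DAB => //.
    exact: d_andE1 (derivable_hd _ _).
  exact: d_andE2 (derivable_hd _ _).
- rewrite IHA IHB; split=> [[]|DAB].
  + by apply: closed1 => //; apply: d_orI1; apply: derivable_hd.
  + by apply: closed1 => //; apply: d_orI2; apply: derivable_hd.
  case: (complete b _ LsA) => DA; [by left|right].
  apply: closed2 DAB DA => //; apply: d_orE (derivable_hd _ _) _ _.
    apply: derivable_exfalso; apply: d_impE (derivable_hd _ _).
    by do 2!apply: derivable_cons; apply: derivable_hd.
  exact: derivable_hd.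
- rewrite IHA IHB; split=> [AB|DAB DA]; last first.
    apply: closed2 DAB DA => //; apply: d_impE (derivable_hd _ _) _.
    by apply: derivable_cons; apply: derivable_hd.
  case: (complete b _ LsA) => [/AB|].
    by apply: closed1 => //; apply: d_impI; apply: derivable_cons (derivable_hd _ _).
  apply: closed1 => //; apply: d_impI; apply: derivable_exfalso.
  by apply: d_impE (derivable_hd _ _); apply: derivable_cons (derivable_hd _ _).
- have LA : formula_of (L b) A by [].
  have LuA : formula_of (L b) (subst (up s) A) by apply/formula_of_subst.
  split=> /= [satA|DA t]; last first.
    apply/IHA => //; rewrite -inst_subst_up; apply: closed1 DA.
      by apply/formula_of_subst.
    exact: d_allE (derivable_hd _ _).
  (* If the universal formula is not in the theory, its negation is, which yields an existential
     statement whose Henkin witness [k] is a counterexample. *)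
  case: (complete b (All (subst (up s) A))) => // DnA.
  have [|k] := wit b (Neg (subst (up s) A)).
    apply: closed1 DnA; first by move=> R; rewrite /= cats0; apply: LuA.
    apply: d_raa; apply: d_impE; first exact: derivable_cons (derivable_hd _ _).
    apply: d_allI; apply: d_raa; apply: d_impE.
      exact: derivable_cons (derivable_hd _ _).
    apply: (@d_exI _ (subst (up (fun i => Var i.+1)) (Neg _)) (Var 0)).
    by rewrite inst_lift_up; apply: derivable_hd.
  move=> DnAk; case: (consis b (inst (subst (up s) A) (Var k))) => //.
  by rewrite inst_subst_up; apply/IHA.
- have LA : formula_of (L b) A by [].
  split=> /= [[t /IHA DA]|/wit[k DA]].
    apply: closed1 (DA LA); first by move=> R; rewrite /= syms_subst; apply: LF.
    by apply: (@d_exI _ _ t); rewrite inst_subst_up; apply: derivable_hd.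
  by exists (Var k); apply/IHA => //; rewrite -inst_subst_up.
Qed.

End Henkin.

(** A form of Robinson's joint consistency theorem, from which both completeness and interpolation
    are read off. *)
Lemma joint_consistency X :
  (forall R, R \in L true -> R \notin L false) ->
  (forall b A, A \in X b -> formula_of (L b) A) ->
  (forall M, model M -> (forall b A, A \in X b -> sat M Var A) -> False) ->
  exists I, [/\ formula_of LA I, derivable (X true) I
               & derivable (X false) (Neg I)].
Proof.
move=> disj LX noM; apply: contrapT => noI.
have [|M [modM satM]] := @insep_model X _ disj; last exact: noM satM.
by split=> // I LI dI dnI; apply: noI; exists I.
Qed.

End Interpolation.

(** The second side is taken empty. The separator is then refuted outright, so deriving it from
    [Neg A :: G] is a contradiction. *)
Lemma completeness G A :
  (forall M, model M -> (forall B, B \in G -> sat M Var B) -> sat M Var A) ->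
  derivable G A.
Proof.
move=> valid; pose L b := if b then flatten (map syms (Neg A :: G)) else [::].
pose X b := if b then Neg A :: G else [::].
have [||M modM satM|I [_ dI dnI]] := @joint_consistency L X; first by [].
- by case=> // B inB R inR; apply/flatten_mapP; exists B.
- apply: (satM true (Neg A) (mem_head _ _)); apply: valid => // B inB.
  by apply: (satM true); rewrite inE inB orbT.
- apply: d_raa; apply: d_impE dI; exact: derivable_weaken dnI.
Qed.

(** The two sides are [A] and [Neg B]. The interpolant may contain free variables even if [A] and
    [B] are sentences. *)
Lemma interpolation A B : (forall R, R \in syms A -> R \notin syms B) ->
  (forall M, model M -> sat M Var A -> sat M Var B) ->
  exists I, [/\ formula_of LA I, derivable [:: A] I & derivable [:: I] B].
Proof.
move=> disj valid; pose L b := if b then syms A else syms (Neg B).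
pose X b := if b then [:: A] else [:: Neg B].
have [||M modM satM|I [LI dI dnI]] := @joint_consistency L X.
- by move=> R /disj; rewrite /= cats0.
- by case=> C; rewrite inE => /eqP ->.
- apply: (satM false (Neg B) (mem_head _ _)); apply: valid => //.
  exact: (satM true A (mem_head _ _)).
- exists I; split=> //; apply: d_raa.
  apply: (@d_impE _ I); last exact/derivable_cons/derivable_hd.
  by apply: derivable_weaken dnI => C; rewrite inE => /eqP ->; apply: mem_head.
Qed.

(** * Translations *)

Definition entails (A B : formula) : Prop :=
  forall M s, model M -> sat M s A -> sat M s B.

Lemma proves_sat T A M s : proves T A -> model M ->
  (forall B, T B -> sat M s B) -> sat M s A.
Proof.
by case=> G [TG d] modM satT; apply: (soundness modM d) => B /TG; apply: satT.
Qed.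

Lemma proves1P A B : proves [set A]%classic B <-> entails A B.
Proof.
split=> [pB M s modM satA|AB].
  by apply: proves_sat pB modM _ => C ->.
exists [:: A]; split=> [C|]; first by rewrite inE => /eqP ->.
by apply: completeness => M modM satA; apply/AB/satA/mem_head.
Qed.

Lemma nth_map_subst s ts i :
  nth Zero (map (subst_t s) ts) i = subst_t s (nth Zero ts i).
Proof.
case: (ltnP i (size ts)) => [lti|lei]; first by rewrite (nth_map Zero).
by rewrite !nth_default ?size_map.
Qed.

Definition atom (R : sym) : formula := @Rel R [tuple Var i | i < arity R].

Lemma nth_vars n i : nth Zero [tuple Var i | i < n] i = if i < n then Var i else Zero.
Proof.
case: ltnP => [lti|lei]; last by rewrite nth_default // size_tuple.
by rewrite -(tnth_nth Zero _ (Ordinal lti)) tnth_mktuple.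
Qed.

Lemma free_atom R i : free i (atom R) = (i < arity R).
Proof.
rewrite -[LHS]/(has (free_t i) [tuple Var i | i < arity R]).
apply/hasP/idP => [[t /tnthP[j ->]]|lti].
  by rewrite tnth_mktuple => /eqP ->.
exists (Var i); last exact: eqxx.
by apply/tnthP; exists (Ordinal lti); rewrite tnth_mktuple.
Qed.

Lemma translate_atom A : translate atom A = A.
Proof.
elim: A => [|t u|t u|R ts|A IHA B IHB|A IHA B IHB|A IHA B IHB|A IHA|A IHA] //=.
- congr Rel; apply: eq_from_tnth => i.
  by rewrite tnth_map tnth_mktuple /= -tnth_nth.
1,2,3: by rewrite IHA IHB.
1,2: by rewrite IHA.
Qed.

Lemma translate_rename tau rho A : (forall R, arity (rho R) = arity R) ->
  translate tau (rename rho A) = translate (tau \o rho) A.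
Proof.
move=> ar; rewrite /rename.
elim: A => [|t u|t u|R ts|A IHA B IHB|A IHA B IHB|A IHA B IHB|A IHA|A IHA] //=.
- congr subst; apply/funext => i; rewrite nth_map_subst nth_vars.
  (* Beyond the arity both sides take the default value [Zero], since [rho] preserves arities. *)
  by case: ltnP => //= lei; rewrite nth_default // size_tuple -ar.
1,2,3: by rewrite IHA IHB.
1,2: by rewrite IHA.
Qed.

Lemma syms_rename rho A : syms (rename rho A) = map rho (syms A).
Proof.
rewrite /rename.
elim: A => [|t u|t u|R ts|A IHA B IHB|A IHA B IHB|A IHA B IHB|A IHA|A IHA] //=;
  by rewrite map_cat IHA IHB.
Qed.

Lemma formula_of_translate L tau A :
  (forall R, R \in syms A -> formula_of L (tau R)) ->
  formula_of L (translate tau A).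
Proof.
elim: A => [|t u|t u|R ts|A IHA B IHB|A IHA B IHB|A IHA B IHB|A IHA|A IHA] //= Ltau.
- by apply/formula_of_subst; apply: Ltau; apply: mem_head.
all: move=> R; rewrite mem_cat => /orP[]; [apply: IHA|apply: IHB] => S inS;
  by apply: Ltau; rewrite mem_cat inS ?orbT.
Qed.

Lemma free_translate tau A i :
  (forall R, R \in syms A -> forall j, free j (tau R) = (j < arity R)) ->
  free i (translate tau A) = free i A.
Proof.
elim: A i => [|t u|t u|R ts|A IHA B IHB|A IHA B IHB|A IHA B IHB|A IHA|A IHA] i //= H.
- apply/idP/idP.
    move/free_subst=> [j]; rewrite H ?mem_head // => ltj fi.
    by apply/hasP; exists (nth Zero ts j); rewrite ?mem_nth ?size_tuple.
  move=> /hasP[_ /(nthP Zero)[j ltj <-] fi]; apply/free_subst.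
  by exists j => //; rewrite H ?mem_head // -(size_tuple ts).
1,2,3: by rewrite IHA ?IHB // => R inR; apply: H; rewrite mem_cat inR ?orbT.
1,2: exact: IHA.
Qed.

Lemma sentence_translate L1 L2 tau A : is_translation L1 L2 tau ->
  sentence_of L1 A -> sentence_of L2 (translate tau A).
Proof.
move=> trtau [LA sA]; split.
  by apply: formula_of_translate => R /LA /trtau[].
by move=> i; rewrite free_translate // => R /LA /trtau[].
Qed.

Lemma is_translation_sub L1 L1' L2 tau : {subset L1' <= L1} ->
  is_translation L1 L2 tau -> is_translation L1' L2 tau.
Proof. by move=> sub trtau R /sub; apply: trtau. Qed.

(** A dummy value for a translation: an arithmetical formula is needed with exactly the first [n]
    variables free, which rules out [Bot] for positive [n]. *)
Definition trivial_formula (n : nat) : formula :=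
  foldr And (Eq Zero Zero) [seq Eq (Var i) (Var i) | i <- iota 0 n].

Lemma free_trivial_formula n i : free i (trivial_formula n) = (i < n).
Proof.
have free_list s : free i (foldr And (Eq Zero Zero)
    [seq Eq (Var j) (Var j) | j <- s]) = (i \in s).
  by elim: s => //= j s ->; rewrite orbb inE.
by rewrite /trivial_formula free_list mem_iota.
Qed.

Lemma syms_trivial_formula n : syms (trivial_formula n) = [::].
Proof. by rewrite /trivial_formula; elim: (iota 0 n). Qed.

(** The structure that [tau] interprets inside [M]. Quantifiers are unrelativized and terms are
    untouched, so its elements are again all terms. *)
Definition translated_model (tau : sym -> formula) (M : set formula) : set formula :=
  fun A => sat M Var (translate tau A).

Lemma sat_translated_model tau M s A :
  sat (translated_model tau M) s A = sat M s (translate tau A).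
Proof.
elim: A s => [|t u|t u|R ts|A IHA B IHB|A IHA B IHB|A IHA B IHB|A IHA|A IHA] s.
- by [].
- by rewrite /= /translated_model /= !subst_t_Var.
- by rewrite /= /translated_model /= !subst_t_Var.
- rewrite /= /translated_model /= !sat_subst; congr sat; apply/funext => i.
  by rewrite nth_map_subst subst_t_Var.
1,2,3: by rewrite /= IHA IHB.
- by apply: eq_forall => t; apply: IHA.
- by apply: eq_exists => t; apply: IHA.
Qed.

Lemma model_translated_model tau M : model M -> model (translated_model tau M).
Proof.
move=> modM; split=> [t|A t u _].
  by rewrite /translated_model /= !subst_t_Var; case: modM => refl _; apply: refl.
rewrite /translated_model /= !subst_t_Var => Mtu.
rewrite -!sat_translated_model !sat_inst !subst_t_Var !sat_translated_model.
have E v : scons v Var = fun i => subst_t (scons v Var) (Var i) by [].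
by rewrite (E t) (E u) (sat_congr _ _ modM Mtu).
Qed.

Lemma entails_translate tau A B : entails A B ->
  entails (translate tau A) (translate tau B).
Proof.
move=> AB M s modM; rewrite -!sat_translated_model; apply: AB.
exact: model_translated_model.
Qed.

(** Compares translations inside a single model; this is how a piecewise translation is replaced by
    the piece that is selected there. *)
Lemma sat_translate_eq M s tau tau' A :
  (forall R, R \in syms A -> forall s', sat M s' (tau R) = sat M s' (tau' R)) ->
  sat M s (translate tau A) = sat M s (translate tau' A).
Proof.
elim: A s => [|t u|t u|R ts|A IHA B IHB|A IHA B IHB|A IHA B IHB|A IHA|A IHA] s //= H.
- by rewrite !sat_subst H ?mem_head.
1,2,3: by rewrite IHA ?IHB // => R inR; apply: H; rewrite mem_cat inR ?orbT.
- by apply: eq_forall => t; apply: IHA.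
- by apply: eq_exists => t; apply: IHA.
Qed.

Lemma sat_translate_id M s tau A :
  (forall R, R \in syms A -> forall s', sat M s' (tau R) = sat M s' (atom R)) ->
  sat M s (translate tau A) = sat M s A.
Proof. by move=> H; rewrite -[in RHS](translate_atom A); apply: sat_translate_eq. Qed.

Lemma sat_translate_arithmetical M s tau A : formula_of LA A ->
  sat M s (translate tau A) = sat M s A.
Proof. by move=> LA; apply: sat_translate_id => R /LA. Qed.

Lemma sat_translate_comp M s tau tau' A :
  sat M s (translate tau' (translate tau A)) =
  sat M s (translate (fun R => translate tau' (tau R)) A).
Proof.
rewrite -sat_translated_model.
elim: A s => [|t u|t u|R ts|A IHA B IHB|A IHA B IHB|A IHA B IHB|A IHA|A IHA] s.
1,2,3: by rewrite sat_translated_model.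
- by rewrite /= !sat_subst sat_translated_model.
1,2,3: by rewrite /= IHA IHB.
- by apply: eq_forall => t; apply: IHA.
- by apply: eq_exists => t; apply: IHA.
Qed.

(** * Definability *)

Notation definable1 L A L' B :=
  (definable L [set A]%classic L' [set B]%classic).

Lemma definable1P L A L' B : definable1 L A L' B <->
  exists tau, is_translation L L' tau /\ entails B (translate tau A).
Proof.
split=> -[tau [trtau H]]; exists tau; split=> //; first exact/proves1P/H.
by move=> _ ->; apply/proves1P.
Qed.

Lemma definable1I tau L A L' B : is_translation L L' tau ->
  entails B (translate tau A) -> definable1 L A L' B.
Proof. by move=> trtau H; apply/definable1P; exists tau. Qed.

Lemma definable1_refl L A B : entails B A -> definable1 L A L B.
Proof.
move=> BA; apply: (@definable1I atom); last by rewrite translate_atom.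
move=> R inR; split; last exact: free_atom.
by move=> S; rewrite inE => /eqP ->.
Qed.

Lemma definable1_trans L1 A L2 B L3 C :
  definable1 L1 A L2 B -> definable1 L2 B L3 C -> definable1 L1 A L3 C.
Proof.
move=> /definable1P[tau [trtau BA]] /definable1P[tau' [trtau' CB]].
apply: (@definable1I (fun R => translate tau' (tau R))).
  move=> R /trtau[LtauR ftauR]; split.
    by apply: formula_of_translate => S /LtauR /trtau'[].
  by move=> i; rewrite free_translate // => S /LtauR /trtau'[].
move=> M s modM satC; rewrite -sat_translate_comp.
by apply: (@entails_translate _ _ _ BA) => //; apply: CB.
Qed.

Lemma definable1_weaken L A A' L' B B' : entails A A' -> entails B' B ->
  definable1 L A L' B -> definable1 L A' L' B'.
Proof.
move=> AA' BB' /definable1P[tau [trtau H]]; apply: (definable1I trtau).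
move=> M s modM satB'; apply: (entails_translate AA') => //.
by apply: H => //; apply: BB'.
Qed.

Lemma definable1_codomain L A L' L'' B : {subset L' <= L''} ->
  definable1 L A L' B -> definable1 L A L'' B.
Proof.
move=> sub /definable1P[tau [trtau H]]; apply: definable1I H.
by move=> R /trtau[LtauR ?]; split=> // S /LtauR /sub.
Qed.

(** Allows a translation for one disjunct to serve the language of the whole disjunction, with dummy
    values on the additional symbols. *)
Lemma definable1_domain L A L' B : definable1 (syms A) A L' B -> definable1 L A L' B.
Proof.
move=> /definable1P[tau [trtau H]].
pose tau' R := if R \in syms A then tau R else trivial_formula (arity R).
apply: (@definable1I tau') => [R _|M s modM satB].
  rewrite /tau'; case: ifP => [/trtau //|_]; split; last exact: free_trivial_formula.
  by rewrite /formula_of syms_trivial_formula.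
rewrite (@sat_translate_eq _ _ _ tau); first exact: H.
by move=> R inR s'; rewrite /tau' inR.
Qed.

(** Since [P] is closed, its truth value in a model does not depend on the arguments substituted
    into [sigma R]; so one and the same piece is selected at all occurrences of all symbols. *)
Lemma definable1_cases L A L' B P : sentence_of L' P ->
  definable1 L A L' (And B P) -> definable1 L A L' (And B (Neg P)) ->
  definable1 L A L' B.
Proof.
move=> [LP sP] /definable1P[tau [trtau H]] /definable1P[tau' [trtau' H']].
pose sigma R := Or (And P (tau R)) (And (Neg P) (tau' R)).
have satP M s s' : sat M s P = sat M s' P by apply: sat_sentence.
apply: (@definable1I sigma) => [R inR|M s modM satB].
  have [[LtauR ftauR] [LtauR' ftauR']] := (trtau R inR, trtau' R inR).
  split=> [S|i]; last by rewrite /= ftauR ftauR' (negPf (sP i)) /= orbb.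
  by rewrite /= cats0 !mem_cat => /orP[/orP[/LP|/LtauR]|/orP[/LP|/LtauR']].
have [sP1|nP1] := pselect (sat M s P).
  rewrite (@sat_translate_eq _ _ _ tau); first exact: H.
  move=> R _ s'; apply/propext => /=; rewrite (satP M s' s).
  by split=> [[[]|[]] //|?]; left.
rewrite (@sat_translate_eq _ _ _ tau'); first exact: H'.
move=> R _ s'; apply/propext => /=; rewrite (satP M s' s).
by split=> [[[]|[]] //|?]; right.
Qed.

Lemma definable1_or L A B L' C : sentence_of L' C ->
  definable1 L A L' C -> definable1 L A L' B -> definable1 L A L' (Or C B).
Proof.
move=> LC AC AB; apply: (definable1_cases LC).
  by apply: definable1_weaken AC => // M s modM [].
by apply: definable1_weaken AB => // M s modM [[]].
Qed.

(** [X] stands for the disjunction of [A] with the join of [B] and [C], and enters only through the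
    two ways of defining it. Where both translations of [A] fail, [tau] must make [B] true and
    [tau'] must make [C] true. *)
Lemma definable1_or_distr L X A B C L' D : sentence A ->
  (forall E, definable1 (syms A) A L' E -> definable1 L X L' E) ->
  (forall E, definable1 (syms B) B L' E -> definable1 (syms C) C L' E ->
    definable1 L X L' E) ->
  definable1 (syms (Or A B)) (Or A B) L' D ->
  definable1 (syms (Or A C)) (Or A C) L' D ->
  definable1 L X L' D.
Proof.
move=> sA hA hBC /definable1P[tau [trtau H]] /definable1P[tau' [trtau' H']].
have subl (K K' : language) : {subset K <= K ++ K'}.
  by move=> R; rewrite mem_cat => ->.
have subr (K K' : language) : {subset K' <= K ++ K'}.
  by move=> R; rewrite mem_cat orbC => ->.
have LA : sentence_of (syms A) A by split.
have trA := is_translation_sub (subl _ _) trtau.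
have trA' := is_translation_sub (subl _ _) trtau'.
have trB := is_translation_sub (subr _ _) trtau.
have trC := is_translation_sub (subr _ _) trtau'.
apply: (definable1_cases (sentence_translate trA LA)).
  by apply: hA; apply: definable1I trA _ => M s modM [].
apply: (definable1_cases (sentence_translate trA' LA)).
  by apply: hA; apply: definable1I trA' _ => M s modM [].
apply: hBC; [apply: definable1I trB _|apply: definable1I trC _];
  move=> M s modM [[satD nA] nA'].
  by case: (H M s modM satD).
by case: (H' M s modM satD).
Qed.

(* The value Bot, for symbols neither in A nor in the range of rho, is junk. *)
Definition glue (A : formula) (rho : sym -> sym) (tau tau' : sym -> formula)
    (S : sym) : formula :=
  if S \in syms A then tau S else
  if pselect (exists R, rho R = S) is left ex then tau' (sval (cid ex)) else Bot.

Lemma glue_left A rho tau tau' S : S \in syms A -> glue A rho tau tau' S = tau S.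
Proof. by rewrite /glue => ->. Qed.

Lemma glue_right A rho tau tau' R : fresh_renaming A rho ->
  glue A rho tau tau' (rho R) = tau' R.
Proof.
case=> _ inj fresh; rewrite /glue (negPf (fresh R)).
by case: pselect => [ex|[]]; [congr tau'; apply: inj; case: (cid ex)|exists R].
Qed.

(** This is the leastness of the supremum: after renaming, the conjuncts have no non-arithmetical
    symbol in common, so translations of [A] and of [B] can be used side by side. *)
Lemma definable1_and_rename A B rho L' C : fresh_renaming A rho ->
  definable1 (syms A) A L' C -> definable1 (syms B) B L' C ->
  definable1 (syms (And A (rename rho B))) (And A (rename rho B)) L' C.
Proof.
move=> fr /definable1P[tau [trtau H]] /definable1P[tau' [trtau' H']].
have [ar _ _] := fr.
apply: (@definable1I (glue A rho tau tau')) => [S|M s modM satC].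
  rewrite /= syms_rename mem_cat; have [inS _|ninS] := boolP (S \in syms A).
    by rewrite glue_left //; apply: trtau.
  by case/mapP => R inR ->; rewrite glue_right // ar; apply: trtau'.
split.
  rewrite (@sat_translate_eq _ _ _ tau); first exact: H.
  by move=> R inR s'; rewrite glue_left.
rewrite translate_rename // (@sat_translate_eq _ _ _ tau'); first exact: H'.
by move=> R inR s' /=; rewrite glue_right.
Qed.

Lemma definable1_rename A rho : (forall R, arity (rho R) = arity R) ->
  definable1 (syms A) A (syms (rename rho A)) (rename rho A).
Proof.
move=> ar; apply: (@definable1I (fun R => atom (rho R))) => // R inR.
split; last by move=> i; rewrite free_atom ar.
by move=> S; rewrite inE => /eqP ->; rewrite syms_rename map_f.
Qed.

(** * Conservative definitions of truth *)

Lemma is_cDEFP A : is_cDEF A <-> [/\ sentence A, ~ entails A Bot,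
  forall B, EA B -> entails A B,
  exists Theta, [/\ formula_of (syms A) Theta, forall i, free i Theta -> i = 0 &
    forall B, sentence_of LA B ->
      entails A (Iff (inst Theta (numeral (goedel B))) B)] &
  forall B, sentence_of LA B -> entails A B -> proves EA B].
Proof.
split=> [[[sA consA EAA [Theta [LT fT T]]] consv]|[sA consA EAA [Theta [LT fT T]] consv]].
  split.
  - by case: (sA A erefl).
  - by move/proves1P.
  - by move=> B EAB; apply/proves1P/EAA.
  - by exists Theta; split=> // B sB; apply/proves1P/T.
  - by move=> B sB /proves1P; apply: consv.
split; first split.
- by move=> _ ->; split.
- by move/proves1P.
- by move=> B EAB; apply/proves1P/EAA.
- by exists Theta; split=> // B sB; apply/proves1P/T.
- by move=> B sB /proves1P; apply: consv.
Qed.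

(** The truth predicate is chosen by cases on [A]: that of [A] where [A] holds, that of [B]
    elsewhere. Conservativity passes from [A] to the weaker disjunction. *)
Lemma is_cDEF_or A B : is_cDEF A -> is_cDEF B -> is_cDEF (Or A B).
Proof.
move=> /is_cDEFP[sA consA EAA [T [LT fT HT]] consvA].
move=> /is_cDEFP[sB consB EAB [U [LU fU HU]] consvB]; apply/is_cDEFP; split.
- by move=> i /=; rewrite negb_or sA sB.
- by move=> AB; apply: consA => M s modM satA; apply: AB => //; left.
- by move=> C EAC M s modM [satA|satB]; [apply: EAA satA|apply: EAB satB].
- exists (Or (And A T) (And (Neg A) U)); split.
  + move=> R /=; rewrite cats0 !mem_cat.
    by move=> /orP[/orP[->|/LT ->]|/orP[->|/LU ->]]; rewrite ?orbT.
  + by move=> i /=; rewrite (negPf (sA i)) /= => /orP[/fT|/fU].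
  + move=> C sC M s modM satAB.
    have [satA|nA] := pselect (sat M s A).
      have := HT C sC M s modM satA; rewrite /Iff /= !sat_inst /=.
      rewrite (sat_sentence _ _ s sA) => -[TC CT].
      by split=> [[[_ /TC]|[]] //|/CT]; left.
    have satB : sat M s B by case: satAB.
    have := HU C sC M s modM satB; rewrite /Iff /= !sat_inst /=.
    rewrite (sat_sentence _ _ s sA) => -[UC CU].
    by split=> [[[]|[_ /UC]] //|/CU]; right.
- by move=> C sC ABC; apply: consvA => // M s modM satA; apply: ABC => //; left.
Qed.

(* An interpolant of A and Imp (rename rho B) C is arithmetical, hence provable
   in EA by conservativity of A; so rename rho B alone proves C, and B is
   conservative as well. *)
Lemma conservative_and_rename A B rho : fresh_renaming A rho ->
  is_cDEF A -> is_cDEF B ->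
  forall C, sentence_of LA C -> entails (And A (rename rho B)) C -> proves EA C.
Proof.
move=> fr /is_cDEFP[sA _ _ _ consvA] /is_cDEFP[sB _ EAB _ consvB] C [LC sC] ABC.
have [ar inj fresh] := fr.
have [||I [LI dI dC]] := @interpolation A (Imp (rename rho B) C).
- move=> R inR; rewrite /= mem_cat negb_or; apply/andP; split; last first.
    by apply/negP => /LC.
  rewrite syms_rename; apply/mapP => -[S _ RE]; move: inR.
  by rewrite RE (negPf (fresh S)).
- by move=> M modM satA satB; apply: ABC.
(* Closes the interpolant by putting [Zero] for its free variables. Nothing is lost, since [A],
   [rename rho B] and [C] are sentences and may be evaluated under [s0]. *)
pose s0 (_ : nat) := Zero; pose J := subst s0 I.
have satJ M s : sat M s J = sat M s0 I by rewrite sat_subst.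
have sJ : sentence_of LA J.
  split; first exact/formula_of_subst.
  by move=> i; apply/negP => /free_subst[].
have EAJ : proves EA J.
  apply: consvA => // M s modM satA; rewrite satJ.
  apply: (soundness modM dI) => D; rewrite inE => /eqP ->.
  by rewrite (sat_sentence _ _ s sA).
apply: consvB => // M s modM satB.
(* [Bot] contains no symbols, so this gluing undoes [rho]: [M'] reads [rho R] as [M] reads [R], and
   has the same arithmetical part. *)
pose sigma := glue Bot rho atom atom; pose M' := translated_model sigma M.
have modM' : model M' by apply: model_translated_model.
have satB' : sat M' s (rename rho B).
  rewrite sat_translated_model translate_rename // sat_translate_id //.
  move=> R _ s'; by rewrite /= /sigma glue_right.
have satI : sat M' s0 I.
  rewrite -(satJ M' s) sat_translated_model sat_translate_arithmetical; last by case: sJ.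
  by apply: proves_sat EAJ (modM) _ => D /EAB BD; apply: BD.
have sB' : sentence (rename rho B).
  move=> i; rewrite /rename free_translate; first exact: sB.
  by move=> R _ j; rewrite free_atom ar.
have := soundness (s := s0) modM' dC.
rewrite /= (sat_sentence _ _ s sB') (sat_sentence _ _ s sC).
rewrite (sat_translated_model _ _ _ C) (sat_translate_arithmetical _ _ _ LC); apply=> //.
by move=> D; rewrite inE => /eqP ->.
Qed.

Lemma is_cDEF_and_rename A B rho : fresh_renaming A rho ->
  is_cDEF A -> is_cDEF B -> is_cDEF (And A (rename rho B)).
Proof.
move=> fr cA cB; have consv := conservative_and_rename fr cA cB.
have [ar _ _] := fr.
move/is_cDEFP: cA => [sA consA EAA [T [LT fT HT]] _].
move/is_cDEFP: cB => [sB _ _ _ _]; apply/is_cDEFP; split.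
- move=> i /=; rewrite negb_or sA /rename free_translate; first exact: sB.
  by move=> R _ j; rewrite free_atom ar.
(* Consistency is conservativity at [Bot]: otherwise EA, and with it [A], would be inconsistent. *)
- move=> /(consv Bot)[] // G [EAG d]; apply: consA => M s modM satA.
  by apply: (soundness modM d) => C /EAG /EAA HC; apply: HC.
- by move=> C /EAA HC M s modM [satA _]; apply: HC.
- exists T; split=> // [R /LT|C /HT HC M s modM [satA _]]; last exact: HC.
  by rewrite /= mem_cat => ->.
- exact: consv.
Qed.

(** * Bounds in the definability preorder *)

Lemma cDEF_sentence (a : cDEF) : sentence_of (syms (sval a)) (sval a).
Proof. by split=> //; case/is_cDEFP: (svalP a). Qed.

Definition meet_cDEF (a b : cDEF) : cDEF :=
  exist is_cDEF _ (is_cDEF_or (svalP a) (svalP b)).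

Definition join_cDEF (a b : cDEF) rho (fr : fresh_renaming (sval a) rho) : cDEF :=
  exist is_cDEF _ (is_cDEF_and_rename fr (svalP a) (svalP b)).

Lemma defines_refl a : defines a a.
Proof. exact: definable1_refl. Qed.

Lemma defines_trans a b c : defines a b -> defines b c -> defines a c.
Proof. exact: definable1_trans. Qed.

Lemma definable1_orl L A B L' C : definable1 (syms A) A L' C ->
  definable1 L (Or A B) L' C.
Proof.
by move/(definable1_domain L); apply: definable1_weaken => // M s modM satA; left.
Qed.

Lemma definable1_orr L A B L' C : definable1 (syms B) B L' C ->
  definable1 L (Or A B) L' C.
Proof.
by move/(definable1_domain L); apply: definable1_weaken => // M s modM satA; right.
Qed.

(** [defines x y] places [x] below [y]; weaker theories lie lower, so the disjunction is the
    infimum. *)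
Lemma defines_meet c a b : defines c (meet_cDEF a b) <-> defines c a /\ defines c b.
Proof.
split=> [H|[ca cb]].
  split; apply: defines_trans H _.
    exact/definable1_orl/definable1_refl.
  exact/definable1_orr/definable1_refl.
apply: definable1_or.
- split; last by case: (cDEF_sentence a).
  by move=> R /= inR; rewrite mem_cat inR.
- by apply: definable1_codomain ca => R /= inR; rewrite mem_cat inR.
- by apply: definable1_codomain cb => R /= inR; rewrite mem_cat inR orbT.
Qed.

Lemma defines_join a b c rho (fr : fresh_renaming (sval a) rho) :
  defines (join_cDEF b fr) c <-> defines a c /\ defines b c.
Proof.
split=> [H|[ac bc]]; last exact: definable1_and_rename.
split; apply: (defines_trans _ H).
  apply: (@definable1_codomain _ _ (syms (sval a))).
    by move=> R /= inR; rewrite mem_cat inR.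
  by apply: definable1_refl => M s modM [].
apply: (@definable1_codomain _ _ (syms (rename rho (sval b)))).
  by move=> R /= inR; rewrite mem_cat inR orbT.
have [ar _ _] := fr; apply: definable1_weaken (definable1_rename (sval b) ar) => //.
by move=> M s modM [].
Qed.

(** The nontrivial half of distributivity, stated for an arbitrary upper bound [d] of the two meets
    so that no renaming for a second join has to be chosen. *)
Lemma defines_meet_join a b c d rho (fr : fresh_renaming (sval b) rho) :
  defines (meet_cDEF a b) d -> defines (meet_cDEF a c) d ->
  defines (meet_cDEF a (join_cDEF c fr)) d.
Proof.
apply: definable1_or_distr; first by case: (cDEF_sentence a).
  by move=> E; apply: definable1_orl.
by move=> E bE cE; apply: definable1_orr; apply: definable1_and_rename.
Qed.

(** * The quotient lattice *)

HB.instance Definition _ := gen_eqMixin cDEFquo.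
HB.instance Definition _ := gen_choiceMixin cDEFquo.

Lemma cls_surj (X : cDEFquo) : exists a, X = cls a.
Proof.
case: X => X [a XE]; exists a; subst X; congr exist; exact: Prop_irrelevance.
Qed.

Lemma quo_le_cls a b : quo_le (cls a) (cls b) <-> defines a b.
Proof.
split=> [[a' [b' [[aa' _] [_ b'b] a'b']]]|ab].
  exact: defines_trans aa' (defines_trans a'b' b'b).
by exists a, b; do !split=> //; exact: defines_refl.
Qed.

Lemma cls_eq a b : defines a b -> defines b a -> cls a = cls b.
Proof.
move=> ab ba; have E : class a = class b.
  apply/seteqP; split=> c [h1 h2].
    by split; [apply: defines_trans ba h1|apply: defines_trans h2 ab].
  by split; [apply: defines_trans ab h1|apply: defines_trans h2 ba].
rewrite /cls; move: (ex_intro _ a _) (ex_intro _ b _); rewrite E => p q.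
by congr exist; apply: Prop_irrelevance.
Qed.

Definition quo_repr (X : cDEFquo) : cDEF := sval (cid (cls_surj X)).

Lemma quo_reprK X : cls (quo_repr X) = X.
Proof. by rewrite /quo_repr; case: (cid _). Qed.

Definition quo_leb (X Y : cDEFquo) : bool := `[< quo_le X Y >].

Lemma quo_lebE X Y : quo_leb X Y = `[< defines (quo_repr X) (quo_repr Y) >].
Proof.
rewrite /quo_leb -{1}(quo_reprK X) -{1}(quo_reprK Y).
by apply/asboolP/asboolP => /quo_le_cls.
Qed.

Lemma quo_leb_refl : reflexive quo_leb.
Proof. by move=> X; rewrite quo_lebE; apply/asboolP/defines_refl. Qed.

Lemma quo_leb_anti : antisymmetric quo_leb.
Proof.
move=> X Y; rewrite !quo_lebE => /andP[/asboolP XY /asboolP YX].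
by rewrite -(quo_reprK X) -(quo_reprK Y); apply: cls_eq.
Qed.

Lemma quo_leb_trans : transitive quo_leb.
Proof.
move=> Y X Z; rewrite !quo_lebE => /asboolP XY /asboolP YZ.
by apply/asboolP; apply: defines_trans XY YZ.
Qed.

HB.instance Definition _ := Order.Le_isPOrder.Build (Order.Disp tt tt) cDEFquo
  quo_leb_refl quo_leb_anti quo_leb_trans.

Definition quo_meet (X Y : cDEFquo) : cDEFquo :=
  cls (meet_cDEF (quo_repr X) (quo_repr Y)).

(** The choice of the renaming is immaterial: [join_cls] gives the same class for every fresh
    one. *)
Definition quo_join (X Y : cDEFquo) : cDEFquo :=
  cls (join_cDEF (quo_repr Y)
    (svalP (cid (fresh_renaming_exists (sval (quo_repr X)))))).

Lemma cls_le a b : (cls a <= cls b)%O <-> defines a b.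
Proof. by rewrite -quo_le_cls; split=> /asboolP. Qed.

Lemma quo_lexI X Y Z : (X <= quo_meet Y Z)%O = (X <= Y)%O && (X <= Z)%O.
Proof.
rewrite -{1 2 3}(quo_reprK X) -{2}(quo_reprK Y) -{2}(quo_reprK Z).
apply/idP/andP=> [/cls_le/defines_meet[XY XZ]|[/cls_le XY /cls_le XZ]].
  by split; apply/cls_le.
exact/cls_le/defines_meet.
Qed.

Lemma quo_leUx X Y Z : (quo_join X Y <= Z)%O = (X <= Z)%O && (Y <= Z)%O.
Proof.
rewrite -{1 2 3}(quo_reprK Z) -{2}(quo_reprK X) -{2}(quo_reprK Y).
apply/idP/andP=> [/cls_le/defines_join[XZ YZ]|[/cls_le XZ /cls_le YZ]].
  by split; apply/cls_le.
exact/cls_le/defines_join.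
Qed.

HB.instance Definition _ := Order.POrder_isMeetSemilattice.Build
  (Order.Disp tt tt) cDEFquo quo_lexI.
HB.instance Definition _ := Order.POrder_isJoinSemilattice.Build
  (Order.Disp tt tt) cDEFquo quo_leUx.

Import Order.LTheory.

(** Both sides are greatest lower bounds of the same two classes, so the result does not depend on
    the representatives chosen in [quo_meet]. *)
Lemma meet_cls a b : (cls a `&` cls b)%O = cls (meet_cDEF a b).
Proof.
apply: le_anti; apply/andP; split.
  rewrite -[X in (X <= _)%O]quo_reprK; apply/cls_le/defines_meet.
  by split; apply/cls_le; rewrite quo_reprK ?leIl ?leIr.
by rewrite lexI; apply/andP; split; apply/cls_le;
  have /defines_meet[] := defines_refl (meet_cDEF a b).
Qed.

Lemma join_cls a b rho (fr : fresh_renaming (sval a) rho) :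
  (cls a `|` cls b)%O = cls (join_cDEF b fr).
Proof.
apply: le_anti; apply/andP; split.
  by rewrite leUx; apply/andP; split; apply/cls_le;
    have /defines_join[] := defines_refl (join_cDEF b fr).
rewrite -[X in (_ <= X)%O]quo_reprK; apply/cls_le/defines_join.
by split; apply/cls_le; rewrite quo_reprK ?leUl ?leUr.
Qed.

Lemma quo_meetUl : left_distributive (@Order.meet _ cDEFquo) Order.join.
Proof.
move=> X Y Z; apply: le_anti; apply/andP; split; last first.
  by rewrite leUx !leI2 ?leUl ?leUr.
have [a ->] := cls_surj X; have [b ->] := cls_surj Y; have [c ->] := cls_surj Z.
have [rho fr] := fresh_renaming_exists (sval a).
rewrite (join_cls b fr) meetC meet_cls.
have [d dE] := cls_surj ((cls a `&` cls c) `|` (cls b `&` cls c))%O.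
rewrite dE; apply/cls_le/defines_meet_join; apply/cls_le;
  by rewrite -meet_cls -dE meetC ?leUl ?leUr.
Qed.

HB.instance Definition _ :=
  Order.Lattice_Meet_isDistrLattice.Build (Order.Disp tt tt) cDEFquo quo_meetUl.

Theorem mainTheorem5 :
  exists (d : Order.disp_t) (lat : Order.DistrLattice d cDEFquo),
    let L : distrLatticeType d := Order.DistrLattice.Pack lat in
    [/\ forall X Y : L, (X <= Y)%O <-> quo_le X Y,
        forall a b : cDEF, exists h : is_cDEF (Or (sval a) (sval b)),
          ((cls a : L) `&` (cls b : L))%O = cls (exist is_cDEF _ h)
      & forall rep : cDEF -> sym -> sym,
          (forall a, fresh_renaming (sval a) (rep a)) ->
          forall a b : cDEF,
          exists h : is_cDEF (And (sval a) (rename (rep a) (sval b))),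
            ((cls a : L) `|` (cls b : L))%O = cls (exist is_cDEF _ h)].
Proof.
exists (Order.Disp tt tt), (Order.DistrLattice.on cDEFquo); split.
- by move=> X Y; split=> /asboolP.
- by move=> a b; exists (is_cDEF_or (svalP a) (svalP b)); apply: meet_cls.
- move=> rep fr a b; exists (is_cDEF_and_rename (fr a) (svalP a) (svalP b)).
  exact: join_cls.
Qed.
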